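(* The number of affine equivalence classes of $2$-level $d$-polytopes is $2^{\Omega(d^2)}$.
   Context: A $d$-polytope $P\subseteq\mathbb{R}^d$ (full-dimensional) is \emph{$2$-level} if there exist a finite system of linear inequalities $Ax\ge b$ ($A\in\mathbb{R}^{m\times d}$ with rows $A_i$, $b\in\mathbb{R}^m$) and a finite point set $V=\{v_1,\dots,v_n\}\subseteq\mathbb{R}^d$ such that $P=\{x: Ax\ge b\}=\mathrm{conv}(V)$ and $A_iv_j-b_i\in\{0,1\}$ for all $i,j$. Two polytopes are affinely equivalent if one is the image of the other under a bijective affine map. *)

(* Defs.v *)
From mathcomp Require Import all_boot all_order all_algebra.
From mathcomp Require Import all_classical all_reals all_analysis.

Set Implicit Arguments.
Unset Strict Implicit.
Unset Printing Implicit Defensive.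

Import Order.TTheory GRing.Theory Num.Theory.
Import numFieldNormedType.Exports.

Local Open Scope classical_set_scope.
Local Open Scope ring_scope.

Definition convex_hull (R : realType) (d : nat) (S : set 'cV[R]_d) :
    set 'cV[R]_d :=
  [set x | exists n (w : 'I_n -> 'cV[R]_d) (a : 'I_n -> R),
    [/\ forall i, S (w i), forall i, 0 <= a i, \sum_i a i = 1
      & x = \sum_i a i *: w i]].

Definition affine_hull (R : realType) (d : nat) (S : set 'cV[R]_d) :
    set 'cV[R]_d :=
  [set x | exists n (w : 'I_n -> 'cV[R]_d) (a : 'I_n -> R),
    [/\ forall i, S (w i), \sum_i a i = 1 & x = \sum_i a i *: w i]].

(* The empty set is not full-dimensional, even when [d = 0]. *)
Definition full_dimensional (R : realType) (d : nat) (P : set 'cV[R]_d) : Prop :=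
  affine_hull P = setT.

Definition halfspace_system (R : realType) (m d : nat) (A : 'M[R]_(m, d))
    (b : 'cV[R]_m) : set 'cV[R]_d :=
  [set x | forall i, b i 0 <= (A *m x) i 0].

(* Boundedness, hence being a polytope, comes from [P = convex_hull (range v)]. *)
Definition two_level_polytope (R : realType) (d : nat) (P : set 'cV[R]_d) : Prop :=
  full_dimensional P /\
  exists m (A : 'M[R]_(m, d)) (b : 'cV[R]_m) n (v : 'I_n -> 'cV[R]_d),
    [/\ P = halfspace_system A b, P = convex_hull (range v)
      & forall i j, (A *m v j) i 0 - b i 0 = 0 \/ (A *m v j) i 0 - b i 0 = 1].

Definition affine_map (R : realType) (d : nat) (f : 'cV[R]_d -> 'cV[R]_d) : Prop :=
  exists (M : 'M[R]_d) (t : 'cV[R]_d), forall x, f x = M *m x + t.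

Definition affinely_equivalent (R : realType) (d : nat) (P Q : set 'cV[R]_d) : Prop :=
  exists f : 'cV[R]_d -> 'cV[R]_d,
    [/\ affine_map f, bijective f & f @` P = Q].

Definition affine_class (R : realType) (d : nat) (P : set 'cV[R]_d) :
    set (set 'cV[R]_d) :=
  [set Q | two_level_polytope Q /\ affinely_equivalent P Q].

Definition two_level_classes (R : realType) (d : nat) :
    set (set (set 'cV[R]_d)) :=
  [set affine_class P | P in @two_level_polytope R d].

Arguments two_level_classes R d : clear implicits.

(* Main.v *)
(* Upper bound (finiteness): the slacks of [d] linearly independent inequalities
   of a 2-level polytope give affine coordinates in which it is the hull of a
   set of 0/1 vectors.
   Lower bound: the stable set polytopes of the bipartite graphs between two
   fixed halves of the [d] coordinates are 2-level and pairwise distinct, and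
   there are about [2 ^ (d ^ 2 / 4)] of them. An affine equivalence between two
   of them maps vertices to vertices, so each of its coordinates is an affine
   functional with values 0 and 1 on stable sets; such a functional involves at
   most one coordinate from each side, so there are at most [2 (d + 1) ^ 2] of
   them. Hence a class contains at most [(2 (d + 1) ^ 2) ^ d = 2 ^ O(d log d)]
   of these polytopes. *)
Require Import Defs.
From mathcomp Require Import all_boot all_order all_algebra.
From mathcomp Require Import all_classical all_reals all_analysis.
From mathcomp Require Import finmap ring lra zify.

Set Implicit Arguments.
Unset Strict Implicit.
Unset Printing Implicit Defensive.

Import Order.TTheory GRing.Theory Num.Theory.
Import numFieldNormedType.Exports.
Local Open Scope classical_set_scope.
Local Open Scope ring_scope.

(** * Affine maps, affine equivalence and hulls *)

Section AffineMaps.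
Variables (R : realType) (d : nat).
Implicit Types (P Q S : set 'cV[R]_d) (f : 'cV[R]_d -> 'cV[R]_d).

Lemma affine_map_sum f (I : finType) (a : I -> R) (w : I -> 'cV[R]_d) :
  affine_map f -> \sum_i a i = 1 ->
  f (\sum_i a i *: w i) = \sum_i a i *: f (w i).
Proof.
move=> [M [t ft]] a1; rewrite ft mulmx_sumr.
under [in RHS]eq_bigr do rewrite ft scalerDr scalemxAr.
by rewrite big_split/= -scaler_suml a1 scale1r.
Qed.

Lemma affine_map_inv f g : affine_map f -> cancel f g -> cancel g f ->
  affine_map g.
Proof.
move=> [M [t ft]] fK gK.
have uM : M \in unitmx.
  (* A kernel vector of [M] would have the same image under [f] as [0], and [f] is injective. *)
  rewrite -unitmx_tr -row_free_unit; apply: inj_row_free => v vM.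
  apply: trmx_inj; rewrite trmx0; apply: (can_inj fK).
  by rewrite !ft mulmx0 -[M]trmxK -trmx_mul vM trmx0.
exists (invmx M), (- (invmx M *m t)) => x.
apply: (can_inj fK); rewrite gK ft mulmxBr !mulmxA mulmxV// !mul1mx.
by rewrite subrK.
Qed.

Lemma affinely_equivalent_refl P : affinely_equivalent P P.
Proof.
exists id; split; last by rewrite image_id.
- by exists 1%:M, 0 => x; rewrite mul1mx addr0.
- by exists id.
Qed.

Lemma affinely_equivalent_sym P Q :
  affinely_equivalent P Q -> affinely_equivalent Q P.
Proof.
move=> [f [af [g fK gK] <-]]; exists g; split.
- exact: affine_map_inv af fK gK.
- by exists f.
- by rewrite image_comp (_ : g \o f = id) ?image_id//; apply/funext.
Qed.

Lemma affinely_equivalent_trans P Q S :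
  affinely_equivalent P Q -> affinely_equivalent Q S -> affinely_equivalent P S.
Proof.
move=> [f [[M [t ft]] bf <-]] [g [[N [u gu]] bg <-]].
exists (g \o f); split; last by rewrite image_comp.
- exists (N *m M), (N *m t + u) => x /=.
  by rewrite gu ft mulmxDr mulmxA addrA.
- exact: bij_comp.
Qed.

Lemma eq_affine_class P Q :
  affinely_equivalent P Q -> affine_class P = affine_class Q.
Proof.
move=> PQ; apply/seteqP; split=> S [S2 eS]; split=> //.
- exact: affinely_equivalent_trans (affinely_equivalent_sym PQ) eS.
- exact: affinely_equivalent_trans PQ eS.
Qed.

Lemma affine_class_inj P Q : two_level_polytope Q ->
  affine_class P = affine_class Q -> affinely_equivalent P Q.
Proof.
move=> Q2 e; have : affine_class Q Q by split=> //; exact: affinely_equivalent_refl.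
by rewrite -e => -[].
Qed.

Lemma convex_hullI S (I : finType) (w : I -> 'cV[R]_d) (a : I -> R) :
  (forall i, S (w i)) -> (forall i, 0 <= a i) -> \sum_i a i = 1 ->
  convex_hull S (\sum_i a i *: w i).
Proof.
move=> Sw a0 a1; exists #|I|, (w \o enum_val), (a \o enum_val); split=> //.
- by move=> i /=; exact: Sw.
- by move=> i /=; exact: a0.
- by rewrite -a1 (reindex _ (onW_bij _ (@enum_val_bij I))).
- by rewrite (reindex _ (onW_bij _ (@enum_val_bij I))).
Qed.

Lemma affine_hullI S (I : finType) (w : I -> 'cV[R]_d) (a : I -> R) :
  (forall i, S (w i)) -> \sum_i a i = 1 ->
  affine_hull S (\sum_i a i *: w i).
Proof.
move=> Sw a1; exists #|I|, (w \o enum_val), (a \o enum_val); split=> //.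
- by move=> i /=; exact: Sw.
- by rewrite -a1 (reindex _ (onW_bij _ (@enum_val_bij I))).
- by rewrite (reindex _ (onW_bij _ (@enum_val_bij I))).
Qed.

Lemma affine_image_hull f S : affine_map f ->
  f @` convex_hull S = convex_hull (f @` S).
Proof.
move=> af; apply/seteqP; split=> [_ [_ [n [w [a [Sw a0 a1 ->]]]] <-]|].
  rewrite affine_map_sum//; apply: convex_hullI => // i; exact: imageP.
move=> _ [n [w [a [Sw a0 a1 ->]]]].
have /choice[v /all_and2[Sv vw]] : forall i, exists y, S y /\ f y = w i.
  by move=> i; have [y] := Sw i; exists y.
exists (\sum_i a i *: v i); first exact: convex_hullI.
by rewrite affine_map_sum//; apply: eq_bigr => i _; rewrite vw.
Qed.

Lemma convex_hull_bounded n (v : 'I_n -> 'cV[R]_d) (k : 'I_d) :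
  exists B, forall x, convex_hull (range v) x -> x k 0 <= B.
Proof.
exists (\sum_j `|v j k 0|) => _ [m [w [a [Sw a0 a1 ->]]]].
rewrite summxE -[leRHS]mul1r -a1 mulr_suml; apply: ler_sum => i _.
rewrite mxE ler_wpM2l//; have [j _ <-] := Sw i.
rewrite (bigD1 j)//= (le_trans (ler_norm _))// lerDl.
by apply: sumr_ge0.
Qed.

End AffineMaps.

(** * Hulls of 0/1 vectors and finiteness of the set of classes *)

Section ZeroOneVectors.
Variables (R : realType) (d : nat).

Definition zo_vec (S : {set 'I_d}) : 'cV[R]_d := \col_i (i \in S)%:R.

Definition zo_hull (T : {set {set 'I_d}}) : set 'cV[R]_d :=
  convex_hull (zo_vec @` [set` T]).

Lemma zo_vecP (x : 'cV[R]_d) :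
  (forall i, x i 0 = 0 \/ x i 0 = 1) -> exists S, x = zo_vec S.
Proof.
move=> x01; exists [set i | x i 0 == 1]%SET; apply/colP => i.
rewrite mxE inE; have [->|->] := x01 i; last by rewrite eqxx.
by rewrite eq_sym oner_eq0.
Qed.

(* A nonzero kernel vector of [A] would make the polytope unbounded. *)
Lemma two_level_row_full (P : set 'cV[R]_d) m (A : 'M[R]_(m, d)) b n
    (v : 'I_n -> 'cV[R]_d) :
  P !=set0 -> P = halfspace_system A b -> P = convex_hull (range v) ->
  row_full A.
Proof.
move=> [x0 Px0] PA Pv.
suff : row_free A^T by rewrite /row_free mxrank_tr.
apply: inj_row_free => u uA.
apply/eqP; apply: contraT => /rV0Pn[k uk].
have [B ltB] := convex_hull_bounded v k.
have Au : A *m u^T = 0 by rewrite -[A]trmxK -trmx_mul uA trmx0.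
have Pt t : P (x0 + t *: u^T).
  by move: Px0; rewrite PA => Px0 i; rewrite mulmxDr -scalemxAr Au scaler0 addr0.
(* The multiple is chosen so that coordinate [k] becomes [B + 1]. *)
have := ltB (x0 + ((B - x0 k 0 + 1) / u 0 k) *: u^T).
rewrite -Pv => /(_ (Pt _)).
rewrite !mxE divfK//; lra.
Qed.

(* The affine map is given by the slacks of [d] linearly independent
   inequalities. *)
Lemma two_level_zo_hull (P : set 'cV[R]_d) : two_level_polytope P ->
  exists T, affinely_equivalent P (zo_hull T).
Proof.
move=> [fP [m [A [b [n [v [PA Pv sl]]]]]]].
have P0 : P !=set0.
  (* An affine combination of no points would have coefficient sum [0], not [1]. *)
  have : affine_hull P 0 by rewrite fP.
  move=> [[|k] [w [a [Pw a1 _]]]].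
    by move: a1; rewrite big_ord0 => /eqP; rewrite eq_sym oner_eq0.
  by exists (w ord0).
have rA := two_level_row_full P0 PA Pv.
pose r := fullrankfun rA; pose M := rowsub r A; pose t := - rowsub r b.
have uM : M \in unitmx by exact: fullrowsub_unit.
pose f x := M *m x + t.
have /fin_all_exists[S vS] : forall j, exists S, f (v j) = zo_vec S.
  move=> j; apply: zo_vecP => i.
  by have := sl (r i) j; rewrite /f /M /t mul_rowsub_mx !mxE.
have af : affine_map f by exists M, t.
exists [set S j | j in 'I_n]%SET, f; split=> //.
- exists (fun y => invmx M *m (y - t)) => x; rewrite /f.
    by rewrite addrK mulKmx.
  by rewrite mulKVmx// subrK.
- rewrite Pv affine_image_hull//; congr convex_hull.
  apply/seteqP; split=> [_ [_ [j _ <-] <-]|_ [_ /imsetP[j _ ->] <-]].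
    by rewrite vS; exists (S j) => //=; apply: imset_f.
  by exists (v j); [exists j | rewrite vS].
Qed.

Lemma finite_two_level_classes : finite_set (two_level_classes R d).
Proof.
apply: (@sub_finite_set _ _ [set affine_class (zo_hull T) | T in setT]).
  move=> _ [P P2 <-]; have [T PT] := two_level_zo_hull P2.
  by exists T => //; rewrite (eq_affine_class PT).
exact/finite_image/finite_finset.
Qed.

End ZeroOneVectors.

Arguments zo_vec R {d} S.

(** The increments of the sorted list up to the entry [y] telescope. Later entries equal to [y] have
    increment [0], so repetitions are harmless. *)
Lemma layer_cake (R : realDomainType) (x y : R) (s : seq R) :
  path <=%R x s -> y \in x :: s ->
  \sum_(k < size s) (s`_k - (x :: s)`_k) * (s`_k <= y)%R%:R = y - x.
Proof.
elim: s x => [|z s IH] x.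
  by rewrite inE big_ord0 => _ /eqP->; rewrite subrr.
move=> xzs; rewrite inE => /predU1P[->|yzs].
  rewrite subrr big1// => k _; case: leP => [sx|_]; last by rewrite mulr0.
  rewrite mulr1; apply/eqP; rewrite subr_eq0 eq_le; apply/andP; split.
    apply: le_trans sx _; case: k => -[|k] //= kz.
    have /allP := order_path_min le_trans xzs; apply; apply: mem_nth.
    exact: ltnW.
  by have /(pathP 0) := xzs; exact.
have /= /andP[xz zs] := xzs.
have zy : z <= y.
  move: yzs; rewrite inE => /predU1P[->//|ys].
  by have /allP := order_path_min le_trans zs; exact.
rewrite big_ord_recl /= zy mulr1 IH//.
by rewrite addrC addrA subrK.
Qed.

Section TwoLevelCriterion.
Variables (R : realType) (d : nat).

(** Arbitrary finite index types allow inequalities to be indexed by a sum type and vertices by a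
    subtype. *)
Lemma two_level_polytopeI (I J : finType) (P : set 'cV[R]_d)
    (a : I -> 'rV[R]_d) (b : I -> R) (v : J -> 'cV[R]_d) :
  full_dimensional P -> P = [set x | forall i, b i <= (a i *m x) 0 0] ->
  P = convex_hull (range v) ->
  (forall i j, (a i *m v j) 0 0 - b i = 0 \/ (a i *m v j) 0 0 - b i = 1) ->
  two_level_polytope P.
Proof.
move=> fP Pa Pv sl; split=> //.
pose A : 'M[R]_(#|I|, d) := \matrix_r a (enum_val r).
have AE r (x : 'cV[R]_d) : (A *m x) r 0 = (a (enum_val r) *m x) 0 0.
  by rewrite !mxE; apply: eq_bigr => k _; rewrite !mxE.
pose c : 'cV[R]_#|I| := \col_r b (enum_val r).
have cE r : c r 0 = b (enum_val r) by rewrite mxE.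
exists #|I|, A, c, #|J|, (v \o enum_val); split.
- rewrite Pa; apply/seteqP; split=> x xP i /=; first by rewrite AE cE; exact: xP.
  by have := xP (enum_rank i); rewrite AE cE enum_rankK.
- rewrite Pv; congr convex_hull; apply/seteqP.
  split=> [_ [j _ <-]|_ [j _ <-]]; last by exists (enum_val j).
  by exists (enum_rank j) => //=; rewrite enum_rankK.
- by move=> i j; rewrite AE cE; exact: sl.
Qed.

End TwoLevelCriterion.

(** * Stable set polytopes of bipartite graphs *)

Section StableSetPolytope.
Variables (R : realType) (d : nat) (L : {set 'I_d}).
Implicit Types (E : {set 'I_d * 'I_d}) (S : {set 'I_d}).

(* The bipartite graph with sides [L] and [~: L]: pairs of [E] which are not
   in [L * ~: L] are ignored. *)
Definition edge E i j := [&& i \in L, j \notin L & (i, j) \in E].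

Definition stable E S :=
  [forall i, forall j, edge E i j ==> ~~ ((i \in S) && (j \in S))].

Definition stable_poly E : set 'cV[R]_d :=
  [set x | (forall i, 0 <= x i 0 <= 1) /\
           forall i j, edge E i j -> x i 0 + x j 0 <= 1].

Lemma stable_polyP E S : stable_poly E (zo_vec R S) <-> stable E S.
Proof.
split=> [[_ eS]|/forallP sS].
  apply/forallP => i; apply/forallP => j; apply/implyP => /eS.
  by rewrite !mxE; do 2!case: (_ \in _) => //=; rewrite -natrD lern1.
split=> [i|i j eij]; first by rewrite mxE; case: (_ \in _); rewrite lexx ler01.
have /forallP/(_ j) := sS i; rewrite eij !mxE.
by do 2!case: (_ \in _) => //=; rewrite -natrD lern1.
Qed.

Lemma stable_single_side E S : S \subset L \/ S \subset (~: L)%SET -> stable E S.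
Proof.
move=> SL; apply/forallP => i; apply/forallP => j; apply/implyP.
move=> /and3P[iL jL _]; apply/negP => /andP[iS jS]; case: SL.
  by move=> /fintype.subsetP /(_ _ jS); rewrite (negbTE jL).
by move=> /fintype.subsetP /(_ _ iS); rewrite inE iL.
Qed.

Lemma stable0 E : stable E finset.set0.
Proof. by apply: stable_single_side; left; apply/fintype.subsetP => i; rewrite inE. Qed.

Lemma stable1 E k : stable E [set k]%SET.
Proof.
apply: stable_single_side; rewrite !finset.sub1set inE.
by case: (boolP (k \in L)); [left|right].
Qed.

Lemma stable2 E k l : (k \in L) = (l \in L) -> stable E [set k; l]%SET.
Proof.
move=> kl; apply: stable_single_side; case: (boolP (k \in L)) => kL; [left|right].
  by apply/fintype.subsetP => i /set2P[]->; rewrite -?kl.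
by apply/fintype.subsetP => i /set2P[]->; rewrite inE -?kl.
Qed.

Lemma stable_poly_convex E : convex_hull (stable_poly E) `<=` stable_poly E.
Proof.
move=> _ [n [w [a [wE a0 a1 ->]]]].
have sumE k : (\sum_i a i *: w i) k 0 = \sum_i a i * w i k 0.
  by rewrite summxE; apply: eq_bigr => i _; rewrite mxE.
split=> [k|k l ekl].
  rewrite sumE -a1; apply/andP; split.
    apply: sumr_ge0 => i _; rewrite mulr_ge0//.
    by have [/(_ k)/andP[]] := wE i.
  apply: ler_sum => i _; rewrite ler_piMr//.
  by have [/(_ k)/andP[]] := wE i.
rewrite !sumE -big_split/= -a1; apply: ler_sum => i _; rewrite -mulrDr ler_piMr//.
by have [_] := wE i; exact.
Qed.

(* Replacing [x j] by [1 - x j] off [L] turns edge inequalities into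
   comparisons of coordinates, which are preserved by thresholding; the layer
   cake formula writes the point as a mean of its thresholdings. *)
Lemma stable_poly_hull E :
  stable_poly E = convex_hull (zo_vec R @` [set` stable E]).
Proof.
apply/seteqP; split; last first.
  move=> x [n [w [a [wS a0 a1 ->]]]]; apply: stable_poly_convex.
  apply: convex_hullI => // i; have [S sS <-] := wS i.
  by apply/stable_polyP.
move=> x [x01 xE].
pose y i := if i \in L then x i 0 else 1 - x i 0.
have y01 i : 0 <= y i <= 1.
  by have := x01 i; rewrite /y; case: ifP => // _; rewrite subr_ge0 gerBl andbC.
(* Including [1] makes the increments of [0 :: s] add up to [1]. *)
pose s := sort <=%R (1 :: [seq y i | i <- enum 'I_d]).
have ps : path <=%R 0 s.
  rewrite path_min_sorted ?sort_le_sorted//.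
  rewrite all_sort /= ler01; apply/allP => _ /mapP[i _ ->].
  by have /andP[] := y01 i.
have s1 z : z \in s -> z <= 1.
  rewrite mem_sort inE => /predU1P[->//|/mapP[i _ ->]].
  by have /andP[] := y01 i.
have y_s i : y i \in 0 :: s.
  by rewrite inE mem_sort inE map_f ?mem_enum ?orbT.
pose a (k : 'I_(size s)) := s`_k - (0 :: s)`_k.
have cake z : z \in 0 :: s -> \sum_k a k * (s`_k <= z)%R%:R = z.
  by move=> zs; rewrite (layer_cake ps zs) subr0.
have a1 : \sum_k a k = 1.
  rewrite -[RHS]cake; last by rewrite inE mem_sort mem_head orbT.
  by apply: eq_bigr => k _; rewrite s1 ?mulr1// mem_nth.
(* Thresholding at [s_k], complemented off [L] to undo the reflection. An edge inside [S k] would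
   give [1 - x j < s_k <= x i], against its inequality. *)
pose S (k : 'I_(size s)) := [set i | (s`_k <= y i) == (i \in L)]%SET.
have -> : x = \sum_k a k *: zo_vec R (S k).
  apply/colP => i; rewrite summxE.
  under eq_bigr do rewrite !mxE inE.
  have := cake _ (y_s i); rewrite /y; case: (i \in L) => yi.
    by rewrite -[LHS]yi; apply: eq_bigr => k _; rewrite eqb_id.
  rewrite [LHS](_ : _ = \sum_k a k - (1 - x i 0)); last by rewrite a1; ring.
  rewrite -[in LHS]yi -sumrB; apply: eq_bigr => k _.
  by case: (_ <= _) => /=; rewrite ?mulr1 ?mulr0 ?subrr ?subr0.
apply: convex_hullI => // k; last first.
  by rewrite subr_ge0; have /(pathP 0) := ps; exact.
exists (S k) => //=; apply/forallP => i; apply/forallP => j; apply/implyP => eij.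
have := xE _ _ eij; move: eij => /and3P[iL jL _].
rewrite !inE /y iL (negbTE jL) eqb_id eqbF_neg -ltNge => xij.
by apply/negP => /andP[]; lra.
Qed.

Lemma stable_poly_full_dimensional E : full_dimensional (stable_poly E).
Proof.
apply/seteqP; split=> // x _.
(* The origin ([None]) and the unit vectors are 0/1 vectors of stable sets and affinely span the
   space. *)
pose w (o : option 'I_d) : 'cV[R]_d :=
  zo_vec R (if o is Some k then [set k]%SET else finset.set0).
pose a (o : option 'I_d) : R :=
  if o is Some k then x k 0 else 1 - \sum_k x k 0.
have sumo (V : zmodType) (F : option 'I_d -> V) :
    \sum_o F o = F None + \sum_k F (Some k).
  rewrite (bigD1 None)//=; congr (_ + _).
  rewrite (reindex_omap Some id) => [|[k|]]//=.
  by apply: eq_bigl => k; rewrite eqxx.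
have -> : x = \sum_o a o *: w o.
  rewrite sumo /w /a; apply/colP => i; rewrite !mxE inE mulr0 add0r summxE.
  rewrite (bigD1 i)//= big1 => [|k ki]; rewrite !mxE inE ?eqxx ?mulr1 ?addr0//.
  by rewrite eq_sym (negbTE ki) mulr0.
apply: affine_hullI; last by rewrite sumo /= subrK.
by move=> [k|]; apply/stable_polyP; [exact: stable1|exact: stable0].
Qed.

Lemma stable_poly_two_level E : two_level_polytope (stable_poly E).
Proof.
pose T := ('I_d + 'I_d + 'I_d * 'I_d)%type.
pose e (i : 'I_d) : 'rV[R]_d := delta_mx 0 i.
pose a (r : T) : 'rV[R]_d := match r with
  | inl (inl i) => e i
  | inl (inr i) => - e i
  | inr (i, j) => if edge E i j then - (e i + e j) else 0
  end.
pose b (r : T) : R := match r with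
  | inl (inl i) => 0
  | inl (inr i) => - 1
  (* Non-edges give the trivial inequality [0 <= 0], with slack always [0]. *)
  | inr (i, j) => if edge E i j then - 1 else 0
  end.
have eE i (x : 'cV[R]_d) : (e i *m x) 0 0 = x i 0 by rewrite -rowE mxE.
have NE (u : 'rV[R]_d) x : (- u *m x) 0 0 = - (u *m x) 0 0.
  by rewrite mulNmx mxE.
have DE (u v : 'rV[R]_d) x : ((u + v) *m x) 0 0 = (u *m x) 0 0 + (v *m x) 0 0.
  by rewrite mulmxDl mxE.
have aE r (x : 'cV[R]_d) : (a r *m x) 0 0 = match r with
  | inl (inl i) => x i 0
  | inl (inr i) => - x i 0
  | inr (i, j) => if edge E i j then - (x i 0 + x j 0) else 0
  end.
  case: r => [[i|i]|[i j]] /=; rewrite ?NE ?eE//.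
  by case: ifP => _; rewrite ?NE ?DE ?eE// mul0mx mxE.
apply: (@two_level_polytopeI _ _ T {S : {set 'I_d} | stable E S} _ a b
  (fun S : {S : {set 'I_d} | stable E S} => zo_vec R (val S))).
- exact: stable_poly_full_dimensional.
- apply/seteqP; split=> [x [x01 xE] r|x xP] /=.
    rewrite aE; case: r => [[i|i]|[i j]] /=.
    + by have /andP[] := x01 i.
    + by rewrite lerN2; have /andP[] := x01 i.
    + by case: ifP => // /xE; rewrite lerN2.
  split=> [i|i j eij].
    have := xP (inl (inl i)); have := xP (inl (inr i)).
    by rewrite !aE /= lerN2 => -> ->.
  by have := xP (inr (i, j)); rewrite !aE /= eij lerN2.
- rewrite stable_poly_hull; congr convex_hull; apply/seteqP.
  split=> [_ [S /= sS <-]|_ [[S sS] _ <-]]; last by exists S.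
  by exists (exist _ S sS).
- move=> r [S sS]; rewrite aE /=; case: r => [[i|i]|[i j]] /=.
  + by rewrite mxE; case: (_ \in _); [right|left]; rewrite subr0.
  + by rewrite mxE; case: (_ \in _); [left|right]; rewrite /=; ring.
  + case: ifP => [eij|_]; last by left; rewrite subrr.
    have /forallP/(_ i)/forallP/(_ j) := sS; rewrite eij !mxE.
    by do 2!case: (_ \in _) => //=; move=> _; [left|left|right]; ring.
Qed.

(** For [i] in [L] and [j] off [L], the pair is an edge exactly when the 0/1 vector of [{i, j}] is
    outside the polytope. *)
Lemma stable_poly_inj :
  {in powerset (finset.setX L (~: L)%SET) &, injective stable_poly}.
Proof.
have stE E i j : i \in L -> j \notin L ->
    stable E [set i; j]%SET = ((i, j) \notin E).
  move=> iL jL; apply/idP/idP.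
    move=> /forallP/(_ i)/forallP/(_ j).
    by rewrite /edge iL jL !inE !eqxx orbT /=; case: (_ \in E).
  move=> ijE; apply/forallP => k; apply/forallP => l; apply/implyP.
  move=> /and3P[kL lL klE]; apply/negP; rewrite !inE => /andP[ki lj].
  have {}ki : k = i by case/orP: ki => /eqP// kj; rewrite kj (negbTE jL) in kL.
  have {}lj : l = j by case/orP: lj => /eqP// li; rewrite li iL in lL.
  by rewrite -ki -lj klE in ijE.
move=> E F; rewrite !powersetE => /fintype.subsetP sE /fintype.subsetP sF EF.
apply/setP => -[i j]; have [ijL|ijL] := boolP ((i, j) \in finset.setX L (~: L)%SET).
  move: ijL; rewrite !inE => /andP[iL jL].
  apply: negb_inj; rewrite -!stE//.
  by apply/idP/idP => /stable_polyP EFs; apply/stable_polyP; rewrite ?EF// -EF.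
by rewrite (contraNF (sE _) ijL) (contraNF (sF _) ijL).
Qed.

(** The image is a convex combination of 0/1 vectors of the target. Pulled back by [f], it writes
    [zo_vec R S] as a combination of points of the unit cube; as a vertex of the cube, it equals
    each point of nonzero weight. *)
Lemma stable_poly_vertex E F f S : affine_map f -> bijective f ->
  f @` stable_poly E = stable_poly F -> stable E S ->
  exists S', f (zo_vec R S) = zo_vec R S'.
Proof.
move=> af bf fEF /stable_polyP SE.
have : stable_poly F (f (zo_vec R S)) by rewrite -fEF; exact: imageP.
rewrite stable_poly_hull => -[n [w [a [wF a0 a1 fS]]]].
have /choice[u /all_and2[uE uw]] : forall i, exists x, stable_poly E x /\ f x = w i.
  move=> i; have : stable_poly F (w i).
    by have [S' sS' <-] := wF i; apply/stable_polyP.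
  by rewrite -fEF => -[x xE <-]; exists x.
have {fS} Su : zo_vec R S = \sum_i a i *: u i.
  apply: (bij_inj bf); rewrite fS affine_map_sum//.
  by apply: eq_bigr => i _; rewrite uw.
have [i ai] : exists i, a i != 0.
  apply/existsP; apply: contraT; rewrite negb_exists => /forallP a_0.
  move: a1; rewrite big1 => [|i _]; last by apply/eqP; rewrite -[_ == _]negbK.
  by move/eqP; rewrite eq_sym oner_eq0.
have [S' _ wS] := wF i; exists S'; rewrite wS -uw; congr f.
apply/colP => k; have u01 j : 0 <= u j k 0 <= 1 by have [] := uE j.
have Sk : (k \in S)%:R = \sum_j a j * u j k 0.
  have /colP/(_ k) := Su; rewrite mxE => ->.
  by rewrite summxE; apply: eq_bigr => j _; rewrite mxE.
rewrite mxE; case: (k \in S) Sk => /= Sk.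
  have /eqP : \sum_j a j * (1 - u j k 0) = 0.
    under eq_bigr do rewrite mulrBr mulr1.
    by rewrite sumrB a1 -Sk subrr.
  rewrite psumr_eq0 => [|j _]; last by rewrite mulr_ge0// subr_ge0; case/andP: (u01 j).
  move=> /allP/(_ i (mem_index_enum _)) /=.
  by rewrite mulf_eq0 (negbTE ai) subr_eq0 => /eqP.
move/esym/eqP: Sk; rewrite psumr_eq0 => [|j _].
  move=> /allP/(_ i (mem_index_enum _)) /=.
  by rewrite mulf_eq0 (negbTE ai) => /eqP.
by rewrite mulr_ge0//; case/andP: (u01 j).
Qed.

(** * Coding the affine equivalences and counting classes *)

Definition row_code : finType := (bool * option 'I_d * option 'I_d)%type.

(* The code [(c, u, v)] stands for the functional [c + s * (x u + x v)], where
   [s] is [1] if [c = 0] and [-1] if [c = 1], and a missing coordinate counts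
   for [0]. *)
Definition row_coef (c : row_code) k : R :=
  if (c.1.2 == Some k) || (c.2 == Some k) then (-1) ^+ c.1.1 else 0.

Definition code_map (c : {ffun 'I_d -> row_code}) (x : 'cV[R]_d) : 'cV[R]_d :=
  (\matrix_(i, k) row_coef (c i) k) *m x + \col_i (c i).1.1%:R.

Lemma optionP_unique (p : pred 'I_d) :
  (forall k l, p k -> p l -> k = l) -> exists o, forall k, p k = (o == Some k).
Proof.
move=> p1; exists [pick k | p k] => k; case: pickP => [l pl|->//].
by apply/idP/eqP => [pk|[<-]//]; congr Some; exact: p1.
Qed.

(* The values of the functional at [0], [e_k] and [e_k + e_l] (for [k] and [l]
   on the same side) are [0] or [1], so that at most one coefficient on each
   side is nonzero. *)
Lemma row_codeP E (m : 'I_d -> R) (t : R) :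
  (forall S, stable E S ->
     \sum_(k in S) m k + t = 0 \/ \sum_(k in S) m k + t = 1) ->
  exists c : row_code, (forall k, m k = row_coef c k) /\ t = c.1.1%:R.
Proof.
move=> h.
have [b tb] : exists b : bool, t = b%:R.
  have := h _ (stable0 E); rewrite big1 => [|k]; last by rewrite inE.
  by rewrite add0r => -[->|->]; [exists false|exists true].
have m0 k : m k = 0 \/ m k = (-1) ^+ b.
  have := h _ (stable1 E k); rewrite big_set1 tb.
  by case: (b) => /= -[] e; [right|left|left|right]; lra.
have mU k l : (k \in L) = (l \in L) -> m k != 0 -> m l != 0 -> k = l.
  move=> kl; have [->|mk] := m0 k; first by rewrite eqxx.
  have [->|ml] := m0 l; first by rewrite eqxx.
  move=> _ _; apply/eqP; apply: contraT => nkl.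
  have := h _ (stable2 E kl); rewrite big_setU1 ?inE//= big_set1 mk ml tb.
  by case: (b) => /= -[] e; exfalso; lra.
have [k l /andP[kL mk] /andP[lL ml]|u uP] :=
    @optionP_unique (fun k => (k \in L) && (m k != 0)).
  by apply: mU => //; rewrite kL lL.
have [k l /andP[kL mk] /andP[lL ml]|v vP] :=
    @optionP_unique (fun k => (k \notin L) && (m k != 0)).
  by apply: mU => //; rewrite (negbTE kL) (negbTE lL).
exists (b, u, v); split=> // k; rewrite /row_coef /= -uP -vP -andb_orl orbN /=.
by have [|] := m0 k => mk; rewrite mk ?eqxx// signr_eq0.
Qed.

Lemma stable_poly_code E F : affinely_equivalent (stable_poly E) (stable_poly F) ->
  exists c, stable_poly F = code_map c @` stable_poly E.
Proof.
move=> [f [af bf fEF]].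
have [M [t ft]] := af.
have /fin_all_exists[c cP] : forall i, exists c : row_code,
    (forall k, M i k = row_coef c k) /\ t i 0 = c.1.1%:R.
  move=> i; apply: (@row_codeP E) => S sS.
  have [S' fS] := stable_poly_vertex af bf fEF sS.
  have -> : \sum_(k in S) M i k + t i 0 = zo_vec R S' i 0.
    rewrite -fS ft !mxE; congr (_ + _); rewrite big_mkcond.
    by apply: eq_bigr => k _; rewrite mxE; case: (_ \in _); rewrite ?mulr1 ?mulr0.
  by rewrite mxE; case: (_ \in _); [right|left].
exists (finfun c); rewrite -fEF; apply: eq_imagel => x _.
rewrite ft /code_map; congr (_ *m x + _).
  by apply/matrixP => i k; rewrite mxE ffunE; have [] := cP i.
by apply/colP => i; rewrite mxE ffunE; have [] := cP i.
Qed.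

(** An edge set between [L] and its complement is determined by the class of its polytope together
    with the code of a map onto it from a fixed representative of that class. *)
Lemma two_level_classes_count :
  (2 ^ (#|L| * (d - #|L|)) <=
     #|` fset_set (two_level_classes R d)| * (2 * d.+1 * d.+1) ^ d)%N.
Proof.
set C := fset_set _.
have inC E : affine_class (stable_poly E) \in C.
  rewrite in_fset_set; last exact: finite_two_level_classes.
  by apply/mem_set; exists (stable_poly E) => //; exact: stable_poly_two_level.
have ltC E : (index (affine_class (stable_poly E)) C < #|` C|)%N.
  by rewrite index_mem.
pose idx E := Ordinal (ltC E).
(* The default is never reached at [idx E], since [E] itself qualifies. *)
pose rep n := odflt finset.set0 [pick E | idx E == n].
have repP E : idx (rep (idx E)) = idx E.
  by rewrite /rep; case: pickP => [F /eqP//|/(_ E)]; rewrite eqxx.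
have /fin_all_exists[code codeP] : forall E, exists c,
    stable_poly E = code_map c @` stable_poly (rep (idx E)).
  move=> E; apply: stable_poly_code; apply: affine_class_inj.
    exact: stable_poly_two_level.
  have /(congr1 val) /= e := repP E; exact: (@index_inj _ set0 C _ _ (inC _) (inC _) e).
pose phi E := (idx E, code E).
have phi_inj : {in powerset (finset.setX L (~: L)%SET) &, injective phi}.
  move=> E F sE sF [ie ce]; apply: stable_poly_inj => //.
  rewrite codeP [RHS]codeP ce; congr (_ @` stable_poly (rep _)).
  exact: val_inj.
have := leq_card_in _ _ phi_inj.
rewrite card_powerset cardsX [#|(~: L)%SET|]cardsCs finset.setCK card_prod card_ffun !card_ord.
by rewrite !card_prod card_bool !card_option !card_ord.
Qed.

End StableSetPolytope.

(** * Numerical estimates and the asymptotic bound *)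

Lemma code_count_bound d : (320 <= d)%N -> (2 * d.+1 * d.+1 <= 2 ^ (d %/ 16))%N.
Proof.
move=> d320.
have u20 : (20 <= d %/ 16)%N by lia.
have du : (d.+1 <= 16 * (d %/ 16).+1)%N by lia.
(* Here [u] stands for [d %/ 16], and [512 = 2 * 16 ^ 2] comes from [du]. The threshold
   [320 = 16 * 20] gives [20 <= u]. *)
suff : forall u, (20 <= u)%N -> (512 * (u.+1 * u.+1) <= 2 ^ u)%N.
  move=> /(_ _ u20); apply: leq_trans.
  by have := leq_mul du du; lia.
move=> u /subnK <-; elim: (u - 20)%N => [|k IH].
  by rewrite add0n (expnD 2 10 10) leq_mul.
rewrite addSn expnS; nia.
Qed.

(** With [L] of size [h = d./2], there are [2 ^ (h * (d - h))] graphs, with exponent at least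
    [d ^ 2 / 8]. Dividing by the number of codes costs at most [d ^ 2 / 16] in the exponent. *)
Lemma two_level_classes_lower (R : realType) d : (320 <= d)%N ->
  exists2 e, (d ^ 2 <= 16 * e)%N &
    (2 ^ e <= #|` fset_set (two_level_classes R d)|)%N.
Proof.
move=> d320; have hd : (d./2 <= d)%N by lia.
have := @two_level_classes_count R d (widen_ord hd @: 'I_d./2)%SET.
rewrite card_imset; last by move=> i j /(congr1 val) /= ?; exact: val_inj.
rewrite card_ord; set N := #|` _|; set h := d./2 => le1.
have le2 : ((2 * d.+1 * d.+1) ^ d <= 2 ^ ((d %/ 16) * d))%N.
  by rewrite expnM leq_exp2r ?code_count_bound//; lia.
have q16 : (16 * (d %/ 16) <= d)%N by lia.
have dh : (d <= h.*2.+1)%N by rewrite /h; lia.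
have dh' : (h.*2 <= d)%N by rewrite /h; lia.
have main : (16 * ((d %/ 16) * d) + d ^ 2 <= 16 * (h * (d - h)))%N.
  have : (16 * (d %/ 16) * d <= d * d)%N by rewrite leq_mul2r q16 orbT.
  suff : (2 * (d * d) <= 16 * (h * (d - h)))%N by rewrite -mulnn; lia.
  have [->|->] : d = h.*2 \/ d = h.*2.+1 by lia.
    by rewrite -addnn addnK; nia.
  rewrite -addnn -addnS addKn; nia.
exists (h * (d - h) - (d %/ 16) * d)%N; first lia.
rewrite -(@leq_pmul2r (2 ^ ((d %/ 16) * d))) ?expn_gt0// -expnD subnK; last lia.
by apply: leq_trans le1 _; rewrite leq_mul2l le2 orbT.
Qed.

Theorem theorem3p4 (R : realType) :
  exists g : nat -> R^o,
    (forall d : nat, counting (two_level_classes R d) = (2 `^ g d)%:E) /\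
    g =Omega_\oo (fun d : nat => (d%:R ^+ 2 : R^o)).
Proof.
pose N d := #|` fset_set (two_level_classes R d)|.
have N0 d : (0 < N d)%N.
  (* With [L] empty the left-hand side is [2 ^ 0], so there is at least one class and the logarithm
     below is meaningful. *)
  have := @two_level_classes_count R d finset.set0.
  by rewrite cards0 mul0n -/(N d); case: (N d).
have ln2 : 0 < ln (2 : R) by rewrite ln_gt0// ltr1n.
(* The base-2 logarithm of the number of classes. *)
exists (fun d => ln (N d)%:R / ln 2); split=> [d|].
  rewrite /counting asboolT; last exact: finite_two_level_classes.
  by rewrite /powR pnatr_eq0 /= divfK ?gt_eqF// lnK// posrE ltr0n N0.
(* The constant comes from [d ^ 2 <= 16 * e]. *)
rewrite eqOmegaE qualifE; apply/asboolP; exists 16^-1; first by rewrite invr_gt0.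
near=> d.
have [|e de eN] := @two_level_classes_lower R d; first by near: d; exact: nbhs_infty_ge.
apply: (@le_trans _ _ e%:R).
  rewrite ger0_norm ?exprn_ge0// ler_pdivrMl// -natrX -natrM ler_nat.
  exact: de.
apply: le_trans (ler_norm _); rewrite ler_pdivlMr// mulr_natl -lnXn//.
by rewrite ler_ln ?posrE ?exprn_gt0 ?ltr0n ?N0// -natrX ler_nat.
Unshelve. all: by end_near. Qed.
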